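(* Let $a_k(x)=\sum_{m=0}^k\binom{2k+2-m}{k-m}x^m$ for $k\ge 0$. Then for every integer $n\ge 0$, $$\det[a_{i+j}(2)]_{0\le i,j\le n}=(-1)^n(2n^2+4n+1).$$
   Context: The determinant is that of the $(n+1)\times(n+1)$ Hankel matrix with $(i,j)$ entry $a_{i+j}(2)$, $0\le i,j\le n$. *)

(* Defs.v *)
From mathcomp Require Import all_boot all_order all_algebra.
Set Implicit Arguments.
Unset Strict Implicit.
Unset Printing Implicit Defensive.
Import GRing.Theory.
Local Open Scope ring_scope.

(* The natural-number subtractions are exact since m <= k throughout. *)
Definition a (k : nat) : {poly int} :=
  \sum_(0 <= m < k.+1) ('C(2 * k + 2 - m, k - m)%N)%:Z *: 'X^m.

Definition hankel (R : Type) (s : nat -> R) (n : nat) : 'M[R]_n.+1 :=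
  \matrix_(i < n.+1, j < n.+1) s (i + j)%N.

(* Main.v *)
From HB Require Import structures.
Require Import Defs.
From mathcomp Require Import all_boot all_order all_algebra.
From mathcomp Require Import ring zify.
Set Implicit Arguments.
Unset Strict Implicit.
Unset Printing Implicit Defensive.
Import GRing.Theory.
Local Open Scope ring_scope.

(** At x = 2 the sum collapses to a_k(2) = 4^(k+1) - C(2k+3, k+1).  Put
t = v + 2 + 1/v and let U_j = v^j + v^(j-2) + ... + v^(-j), monic of degree j
in t.  The functional M : t^k |-> a_k(2) is 4 times evaluation at t = 4 minus
half the constant term of t^2 times the argument, so M(U_j) = 4j + [j = 0].
A Hankel determinant is unchanged when the monomials indexing rows and columns
are replaced by monic polynomials of the same degrees.  With rows 1 and
(t - 4) U_(i-1), and columns U_j, row i >= 1 has entries 1, 2, 1 in columns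
i-2, i-1, i, hence annihilates c_j = (-1)^j (j+1).  Replacing column 0 by the
combination with coefficients c_j makes that column vanish except for its top
entry sum_j c_j M(U_j) = (-1)^n (2n^2 + 4n + 1), whose minor is unitriangular. *)

(** * Partial sums of binomial rows and the value at x = 2 *)

Definition binsum (N k : nat) : nat := (\sum_(0 <= j < k.+1) 'C(N, j))%N.

Lemma binsumS N k : binsum N.+1 k.+1 = (2 * binsum N k + 'C(N, k.+1))%N.
Proof.
rewrite /binsum big_nat_recl // bin0.
rewrite (eq_bigr (fun j => 'C(N, j.+1) + 'C(N, j))%N); last by move=> j _; rewrite binS.
rewrite big_split /= addnA.
have -> : (1 + \sum_(0 <= i < k.+1) 'C(N, i.+1) = \sum_(0 <= j < k.+2) 'C(N, j))%N.
  by rewrite [RHS]big_nat_recl // bin0.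
by rewrite big_nat_recr //=; lia.
Qed.

(** By symmetry this is half of row 2m+1, whose total is 2^(2m+1). *)
Lemma binsum_half m : binsum (2 * m + 1) m = (4 ^ m)%N.
Proof.
elim: m => [|m IHm]; first by rewrite /binsum big_nat1.
have -> : (2 * m.+1 + 1 = (2 * m + 1).+2)%N by lia.
have H : (binsum (2 * m + 1).+1 m.+1 = binsum (2 * m + 1).+1 m + 'C((2 * m + 1).+1, m.+1))%N.
  by rewrite /binsum big_nat_recr.
have S : 'C(2 * m + 1, m.+1) = 'C(2 * m + 1, m).
  by rewrite -bin_sub; [congr ('C(_, _)); lia | lia].
rewrite binsumS expnS -IHm; move: H; rewrite binsumS binS S; lia.
Qed.

(** For fixed r, both sides obey f(k+1) = 2 f(k) + C(k+r+1, k+1): on the left this splits off m = 0,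
    on the right it is [binsumS]. *)
Lemma sum_bin_pow2 r k :
  (\sum_(0 <= m < k.+1) 'C(k + r - m, k - m) * 2 ^ m = binsum (k + r).+1 k)%N.
Proof.
elim: k => [|k IHk].
  by rewrite big_nat1 /binsum big_nat1 !bin0.
rewrite big_nat_recl // addSn binsumS -IHk !subn0 muln1 addnC; congr addn.
rewrite big_distrr /=; apply: eq_bigr => m _.
by rewrite !subSS expnS; lia.
Qed.

Lemma a2E k : (a k).[2] = 4 * 4 ^+ k - 'C(2 * k + 3, k.+1)%:Z.
Proof.
have -> : (a k).[2] = (\sum_(0 <= m < k.+1) 'C(k + (k + 2) - m, k - m) * 2 ^ m)%N%:Z.
  rewrite /a horner_sum -natz natr_sum; apply: eq_bigr => m _.
  by rewrite hornerZ hornerXn natrM natrX natz; congr ('C(_ - _, _)%:Z * _); lia.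
rewrite sum_bin_pow2.
have H := binsumS (2 * k + 2) k; have := binsum_half k.+1.
have -> : (2 * k.+1 + 1 = (2 * k + 2).+1)%N by lia.
have -> : ((k + (k + 2)).+1 = (2 * k + 2).+1)%N by lia.
have -> : (2 * k + 3 = (2 * k + 2).+1)%N by lia.
rewrite {1}/binsum big_nat_recr //= -/(binsum _ _) => E.
by rewrite -exprS -[4 ^+ _]natrX -E; lia.
Qed.

(** * Moment functionals and change of basis in Hankel determinants *)

Section Moments.

Variables (R : comNzRingType) (s : nat -> R).
Implicit Types p q : {poly R}.

Definition moment p : R := \sum_(k < size p) p`_k * s k.

Lemma moment_wide n p : (size p <= n)%N -> moment p = \sum_(k < n) p`_k * s k.
Proof.
move=> le_pn; rewrite /moment (big_ord_widen n (fun k => p`_k * s k) le_pn).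
rewrite big_mkcond; apply: eq_bigr => k _.
by case: ltnP => // le_pk; rewrite nth_default // mul0r.
Qed.

Lemma moment_is_linear : scalar moment.
Proof.
move=> c p q; pose n := maxn (size (c *: p + q)) (maxn (size p) (size q)).
rewrite !(moment_wide (n := n)) ?leq_max ?leqnn ?orbT // mulr_sumr -big_split /=.
by apply: eq_bigr => k _; rewrite coefD coefZ mulrDl mulrA.
Qed.

HB.instance Definition _ :=
  GRing.isLinear.Build R {poly R} R *%R moment moment_is_linear.

Lemma momentZ c p : moment (c *: p) = c * moment p.
Proof. exact: linearZ. Qed.

Lemma momentD p q : moment (p + q) = moment p + moment q.
Proof. exact: raddfD. Qed.

Lemma momentB p q : moment (p - q) = moment p - moment q.
Proof. exact: raddfB. Qed.

Lemma momentXn k : moment 'X^k = s k.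
Proof.
rewrite (moment_wide (n := k.+1)) ?size_polyXn // (bigD1 ord_max) //= big1 => [|i ne_ik].
  by rewrite coefXn eqxx mul1r addr0.
rewrite coefXn; case: eqP => [/= eik|]; last by rewrite mul0r.
by case/eqP: ne_ik; apply: val_inj.
Qed.

(** The new matrix is the Hankel matrix multiplied on both sides by coefficient matrices, which are
    unitriangular for monic bases. Rows and columns may use different bases. *)
Lemma det_hankel_basis n (p q : nat -> {poly R}) :
    (forall i, p i \is monic /\ size (p i) = i.+1) ->
    (forall i, q i \is monic /\ size (q i) = i.+1) ->
  \det (hankel s n) = \det (\matrix_(i < n.+1, j < n.+1) moment (p i * q j)).
Proof.
move=> mon_p mon_q.
pose A (r : nat -> {poly R}) := \matrix_(i < n.+1, j < n.+1) (r i)`_j.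
have detA r : (forall i, r i \is monic /\ size (r i) = i.+1) -> \det (A r) = 1.
  move=> mon_r; rewrite det_trig.
    rewrite big1 // => i _; rewrite mxE.
    by have [/monicP <- size_r] := mon_r i; rewrite lead_coefE size_r.
  apply/is_trig_mxP => i j lt_ij; rewrite mxE nth_default //.
  by have [_ ->] := mon_r i.
have expand r (i : 'I_n.+1) : (forall i, r i \is monic /\ size (r i) = i.+1) ->
    r i = \sum_(k < n.+1) (A r i k) *: 'X^k.
  move=> mon_r; have [_ size_r] := mon_r i.
  rewrite -[LHS]coefK poly_def size_r.
  rewrite (big_ord_widen n.+1 (fun k => (r i)`_k *: 'X^k) (ltn_ord i)) big_mkcond.
  apply: eq_bigr => k _; rewrite mxE; case: ltnP => // le_ik.
  by rewrite nth_default ?size_r // scale0r.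
transitivity (\det (A p *m hankel s n *m (A q)^T)).
  by rewrite !det_mulmx det_tr !detA // mul1r mulr1.
congr (\det _); apply/matrixP => i j; rewrite !mxE.
rewrite (expand p i mon_p) (expand q j mon_q) mulr_sumr raddf_sum.
apply: eq_bigr => l _; rewrite !mxE mulr_suml mulr_suml raddf_sum.
apply: eq_bigr => k _.
by rewrite -scalerAl -scalerAr -exprD scalerA /= momentZ momentXn !mxE mulrAC.
Qed.

End Moments.

(** * Rescaled Chebyshev polynomials in t, where t - 2 = v + 1/v *)

(* [cheb n] is U_n and [cheb1 n] is v^n + v^(-n); hence [cheb1 0] is 2, not 1. *)
Fixpoint cheb (n : nat) : {poly int} :=
  match n with
  | 0%N => 1
  | n'.+1 => ('X - 2%:P) * cheb n' - (if n' is n''.+1 then cheb n'' else 0)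
  end.

Fixpoint cheb1 (n : nat) : {poly int} :=
  match n with
  | 0%N => 2%:P
  | n'.+1 => if n' is n''.+1 then ('X - 2%:P) * cheb1 n' - cheb1 n'' else 'X - 2%:P
  end.

Lemma nat_ind2 (P : nat -> Prop) :
  P 0%N -> P 1%N -> (forall n, P n -> P n.+1 -> P n.+2) -> forall n, P n.
Proof.
move=> P0 P1 PS n; suff [] : P n /\ P n.+1 by [].
by elim: n => // n [Pn Pn1]; split=> //; apply: PS.
Qed.

Lemma chebSS n : cheb n.+2 = ('X - 2%:P) * cheb n.+1 - cheb n.
Proof. by []. Qed.

Lemma cheb1SS n : cheb1 n.+2 = ('X - 2%:P) * cheb1 n.+1 - cheb1 n.
Proof. by []. Qed.

Lemma cheb_monic n : cheb n \is monic /\ size (cheb n) = n.+1.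
Proof.
elim/nat_ind2: n => [||n [_ sz0] [mon1 sz1]].
- by rewrite monic1 size_poly1.
- by rewrite /= mulr1 subr0 monicXsubC size_XsubC.
have szM : size (('X - 2%:P) * cheb n.+1) = n.+3.
  by rewrite size_monicM ?monicXsubC ?monic_neq0 // size_XsubC sz1.
have lt_sz : (size (- cheb n) < size (('X - 2%:P) * cheb n.+1)%R)%N.
  by rewrite szM size_polyN sz0.
rewrite chebSS size_polyDl // szM; split=> //.
by rewrite monicE lead_coefDl // -monicE monicMl ?monicXsubC.
Qed.

Lemma cheb_cheb1 n : cheb n.+2 - cheb n = cheb1 n.+2.
Proof.
elim/nat_ind2: n => [||n IH0 IH1].
- by rewrite /=; ring.
- by rewrite /=; ring.
by rewrite cheb1SS -IH0 -IH1 [cheb n.+4]chebSS [cheb n.+2]chebSS; ring.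
Qed.

(** At t = 4 one has v = 1, and each of the n+1 powers of v in U_n equals 1. *)
Lemma cheb4 n : (cheb n).[4] = n.+1%:Z.
Proof.
elim/nat_ind2: n => [||n IH0 IH1].
- by rewrite hornerC.
- by rewrite /= mulr1 subr0 !hornerE.
rewrite chebSS hornerD hornerN hornerM IH0 IH1 !hornerE; lia.
Qed.

(** * Moments of the Chebyshev basis *)

(* Half the constant term of t^(k+2) in v. *)
Definition cbin (k : nat) : int := 'C(2 * k + 3, k.+1)%:Z.

Lemma moment_a2 p :
  moment (fun k => (a k).[2]) p = 4 * p.[4] - moment cbin p.
Proof.
rewrite /moment horner_coef mulr_sumr -sumrB; apply: eq_bigr => k _.
rewrite a2E /cbin; ring.
Qed.

(** Half the constant term of t^(k+2) (v^n + v^(-n)) is the coefficient of v^n in t^(k+2) =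
    (1+v)^(2k+4) / v^(k+2). The statement keeps k general because the recurrence in n raises the
    power of t. *)
Lemma moment_cbin_cheb1 k n :
  moment cbin ('X^k * cheb1 n) = 'C(2 * k + 4, k + 2 + n)%:Z.
Proof.
have shift (p : {poly int}) j : moment cbin ('X^j * (('X - 2%:P) * p)) =
    moment cbin ('X^(j.+1) * p) - 2 * moment cbin ('X^j * p).
  have -> : 'X^j * (('X - 2%:P) * p) = (-2) *: ('X^j * p) + 'X^(j.+1) * p.
    by rewrite -mul_polyC exprS polyCN; ring.
  rewrite momentD momentZ; ring.
have bin_sym j : 'C(2 * j + 3, j + 2) = 'C(2 * j + 3, j.+1).
  by rewrite -bin_sub; [congr ('C(_, _)) |]; lia.
(* Pascal's rule twice: multiplication by t = v + 2 + 1/v, read on coefficients. *)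
have step j m : 'C(2 * j.+1 + 4, (j.+1 + 2 + m))%:Z =
    'C(2 * j + 4, (j + 2 + m).+1)%:Z + 2 * 'C(2 * j + 4, (j + 2 + m))%:Z
    + 'C(2 * j + 4, (j + 1 + m))%:Z.
  have -> : (2 * j.+1 + 4 = (2 * j + 4).+2)%N by lia.
  have -> : (j.+1 + 2 + m = (j + 1 + m).+2)%N by lia.
  have -> : (j + 2 + m = (j + 1 + m).+1)%N by lia.
  rewrite !binS; lia.
have cheb10 j : moment cbin ('X^j * cheb1 0) = 'C(2 * j + 4, j + 2 + 0)%:Z.
  rewrite /= mulrC mul_polyC momentZ momentXn /cbin.
  have -> : (2 * j + 4 = (2 * j + 3).+1)%N by lia.
  by rewrite addn0 [in RHS]addn2 binS -(addn2 j) bin_sym; lia.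
elim/nat_ind2: n k => [||n IH0 IH1] k; first exact: cheb10.
  rewrite /= -['X - _]mulr1 shift !mulr1 !momentXn.
  have H j : 2 * cbin j = 'C(2 * j + 4, j + 2)%:Z.
    have := cheb10 j.
    by rewrite /= mulrC mul_polyC momentZ momentXn addn0.
  have := H k; have := H k.+1; have := step k 0%N; rewrite !addn0 addn1.
  have : 'C(2 * k + 4, k.+1) = 'C(2 * k + 4, (k + 2).+1).
    by rewrite -bin_sub; [congr ('C(_, _)) |]; lia.
  rewrite addn1; lia.
rewrite cheb1SS mulrBr momentB shift !IH0 !IH1.
have := step k n.+1.
have -> : ((k + 2 + n.+1).+1 = k + 2 + n.+2)%N by lia.
have -> : (k + 1 + n.+1 = k + 2 + n)%N by lia.
lia.
Qed.

(** By [cheb_cheb1], passing from n to n+2 adds C(4, n+4), which is 1 for n = 0 and 0 afterwards;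
    the starting values are 3 and 4. *)
Lemma moment_cbin_cheb n : moment cbin (cheb n) = 4 - (n == 0%N)%:Z.
Proof.
elim/nat_ind2: n => [||n IH0 _].
- exact: (momentXn cbin 0).
- have := moment_cbin_cheb1 0 1.
  by rewrite mul1r /= mulr1 subr0 => ->.
rewrite -[cheb n.+2](subrK (cheb n)) cheb_cheb1 momentD IH0.
have := moment_cbin_cheb1 0 n.+2; rewrite mul1r => ->.
by case: n {IH0} => //= n; rewrite bin_small //; lia.
Qed.

Local Notation mu := (moment (fun k => (a k).[2])).

Lemma moment_a2_cheb n : mu (cheb n) = 4 * n%:Z + (n == 0%N)%:Z.
Proof. rewrite moment_a2 cheb4 moment_cbin_cheb; lia. Qed.

Lemma moment_a2_cheb_mul i j :
  mu (('X - 4%:P) * cheb i * cheb j)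
  = 2 * (i == j)%:Z + (i == j.+1)%:Z + (j == i.+1)%:Z.
Proof.
(* (t-4) U_n = U_(n+1) - 2 U_n + U_(n-1) takes a second difference of 4n + [n = 0]: the linear part
   cancels away from the edge n = 0. *)
have base n : mu (('X - 4%:P) * cheb n) = 2 * (n == 0%N)%:Z + (n == 1%N)%:Z.
  case: n => [|n].
    have -> : ('X - 4%:P) * cheb 0 = (-2) *: cheb 0 + cheb 1.
      by rewrite -mul_polyC /=; ring.
    by rewrite momentD momentZ !moment_a2_cheb.
  have -> : ('X - 4%:P) * cheb n.+1 = cheb n.+2 + (-2) *: cheb n.+1 + cheb n.
    by rewrite -mul_polyC chebSS polyCN; ring.
  rewrite (momentD _ _ (cheb n)) (momentD _ _ (_ *: _)) momentZ !moment_a2_cheb.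
  lia.
elim/nat_ind2: i j => [||i IH0 IH1] j.
- rewrite mulr1 base; lia.
- case: j => [|j]; first by rewrite mulr1 base.
  have -> : ('X - 4%:P) * cheb 1 * cheb j.+1
      = ('X - 4%:P) * cheb j.+2 + ('X - 4%:P) * cheb j.
    by rewrite chebSS /=; ring.
  rewrite momentD !base; lia.
case: j => [|j].
  rewrite mulr1 base; lia.
(* Both (U_(i+2) + U_i) U_(j+1) and U_(i+1) (U_(j+2) + U_j) equal (t-2) U_(i+1) U_(j+1). *)
have -> : ('X - 4%:P) * cheb i.+2 * cheb j.+1
    = ('X - 4%:P) * cheb i.+1 * cheb j.+2 + ('X - 4%:P) * cheb i.+1 * cheb j
      - ('X - 4%:P) * cheb i * cheb j.+1.
  by rewrite !chebSS; ring.
rewrite momentB momentD !IH0 !IH1; lia.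
Qed.

(** * The kernel vector and the determinant *)

Definition kercheb (j : nat) : int := (-1) ^+ j * j.+1%:Z.

(* The partial sums vanish except at the right edge of the band. *)
Lemma sum_band_kercheb (i m : nat) :
  \sum_(k < m) (2 * (i == k)%:Z + (i == k.+1)%:Z + (nat_of_ord k == i.+1)%:Z)
               * kercheb k
  = (-1) ^+ i * ((m == i.+1)%:Z * i.+2%:Z - (m == i)%:Z * i%:Z).
Proof.
elim: m => [|m IHm]; first by rewrite big_ord0; case: i => [|i]; rewrite /=; ring.
rewrite big_ord_recr /= IHm /kercheb.
have neqS p : ((p == p.+1) = false) * ((p.+1 == p) = false)
    * ((p == p.+2) = false) * ((p.+2 == p) = false) by do !split; lia.
have [->|ne_mi] := eqVneq m i.
  by rewrite ?eqxx !neqS /= !intS; ring.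
have [->|ne_mi1] := eqVneq m i.+1.
  by rewrite !neqS /= exprS !intS; ring.
have [->|ne_m1i] := eqVneq i m.+1.
  by rewrite !neqS /= exprS !intS; ring.
by rewrite eqSS (negbTE ne_mi) /=; ring.
Qed.

Lemma sum_moment_kercheb n :
  \sum_(k < n.+1) (4 * k%:Z + (nat_of_ord k == 0%N)%:Z) * kercheb k
  = (-1) ^+ n * (2 * n%:Z ^+ 2 + 4 * n%:Z + 1).
Proof.
elim: n => [|n IHn]; first by rewrite big_ord_recr big_ord0.
rewrite big_ord_recr /= IHn /kercheb [(-1) ^+ n.+1]exprS !intS /=; ring.
Qed.

Theorem corollary1 (n : nat) :
  \det (hankel (fun k : nat => (a k).[2]) n)
  = (-1) ^+ n * (2 * n%:Z ^+ 2 + 4 * n%:Z + 1).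
Proof.
pose r i := if i is i'.+1 then ('X - 4%:P) * cheb i' else 1 : {poly int}.
have monic_r i : r i \is monic /\ size (r i) = i.+1.
  case: i => [|i]; first by rewrite monic1 size_poly1.
  have [mon sz] := cheb_monic i; rewrite /r monicMl ?monicXsubC //.
  by rewrite size_monicM ?monicXsubC ?monic_neq0 // size_XsubC sz.
rewrite (det_hankel_basis _ n monic_r cheb_monic).
set W := (X in \det X).
(* Right multiplication by [C] performs the replacement of column 0; its diagonal is all ones since
   [kercheb 0] is 1. *)
pose C : 'M[int]_n.+1 := \matrix_(i, j) if j == 0 then kercheb i else (i == j)%:R.
have detC : \det C = 1.
  rewrite det_trig.
    by apply: big1 => i _; rewrite mxE eqxx; case: eqP => // ->; rewrite /kercheb.
  apply/is_trig_mxP => i j lt_ij; rewrite mxE ifN; last first.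
    by rewrite -val_eqE /= gtn_eqF // (leq_ltn_trans _ lt_ij).
  by rewrite -val_eqE /= ltn_eqF.
have <- : \det (W *m C) = \det W by rewrite det_mulmx detC mulr1.
have W0 k : W 0 k = 4 * k%:Z + (nat_of_ord k == 0%N)%:Z.
  by rewrite mxE mul1r moment_a2_cheb.
have WS (i : 'I_n) k : W (lift 0 i) k =
    2 * (nat_of_ord i == k)%:Z + (nat_of_ord i == k.+1)%:Z + (nat_of_ord k == i.+1)%:Z.
  by rewrite mxE moment_a2_cheb_mul.
have WC0 i : (W *m C) i 0 = \sum_(k < n.+1) W i k * kercheb k.
  by rewrite mxE; apply: eq_bigr => k _; rewrite [C _ _]mxE.
have WCS i (j : 'I_n) : (W *m C) i (lift 0 j) = W i (lift 0 j).
  rewrite mxE (bigD1 (lift 0 j)) //= big1 ?addr0 => [|k ne_kj].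
    by rewrite [C _ _]mxE eqxx mulr1.
  by rewrite [C _ _]mxE (negbTE ne_kj) mulr0.
rewrite (expand_det_col _ 0) (bigD1 0) //= [X in _ + X]big1 ?addr0 => [|i].
  rewrite WC0 (eq_bigr _ (fun k _ => congr2 *%R (W0 k) erefl)) sum_moment_kercheb.
  (* In the minor, entry (i, j) comes from row i+1 and column j+1, so the right edge of the band,
     with value 1, lies on the diagonal. *)
  rewrite /cofactor expr0 mul1r det_trig; last first.
    apply/is_trig_mxP => i j lt_ij.
    rewrite 2!mxE WCS WS; move: lt_ij; rewrite /= /bump /=; lia.
  rewrite big1 ?mulr1 // => i _.
  by rewrite 2!mxE WCS WS /= /bump /=; lia.
case: (unliftP 0 i) => [j ->|->] // _; rewrite WC0.
(* Here j < n, so the n+1 columns contain the whole band of row j+1 and both boundary terms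
   vanish. *)
rewrite (eq_bigr _ (fun k _ => congr2 *%R (WS j k) erefl)) sum_band_kercheb.
have lt_jn := ltn_ord j.
rewrite eqSS (gtn_eqF lt_jn) (gtn_eqF (leqW lt_jn)) !mul0r subrr mulr0.
by rewrite mul0r.
Qed.
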